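(* Let $B$ be a basis in a matroid $M$. Let $x,y\notin B$ be elements of the ground set with $x\neq y$, let $b\in C(x,B)\cap C(y,B)$, and let $B_{b,x}=B-b+x$ (which is a basis of $M$). Then $$C(x,B)\bigtriangleup C(y,B)\subseteq C(y,B_{b,x})\subseteq C(x,B)\cup C(y,B).$$
   Context: Matroids have a finite ground set. For a set $X$ and an element $x$, $X+x=X\cup\{x\}$ and $X-x=X\setminus\{x\}$. For a basis $B$ of $M$ and an element $y\notin B$ of the ground set, $C(y,B)$ denotes the unique circuit contained in $B+y$. $X\bigtriangleup Y=(X\setminus Y)\cup(Y\setminus X)$ denotes symmetric difference. *)

(* Defs.v *)
From mathcomp Require Import all_boot.
Set Implicit Arguments.
Unset Strict Implicit.
Unset Printing Implicit Defensive.

(* The ground set is an arbitrary subset of [T], so it may be empty and need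
   not be a type of its own. *)
Record matroid (T : finType) := Matroid {
  ground : {set T};
  indep : pred {set T};
  indep_ground : forall I : {set T}, indep I -> I \subset ground;
  indep0 : indep set0;
  indepS : forall I J : {set T}, I \subset J -> indep J -> indep I;
  indep_aug : forall I J : {set T}, indep I -> indep J -> #|I| < #|J| ->
    exists2 e, e \in J :\: I & indep (e |: I)
}.

Section Matroid.
Variables (T : finType) (M : matroid T).
Implicit Types (A B C I J : {set T}) (x y b e : T).

Definition basis B : bool := maxset (indep M) B.

Definition dependent : pred {set T} :=
  fun A => (A \subset ground M) && ~~ indep M A.

Definition circuit C : bool := minset dependent C.

(* C(y, B); the default value [set0] is never taken when [B] is a basis and
   [y] is in the ground set but not in [B], see [fund_circuitP] and
   [fund_circuit_uniq]. *)
Definition fund_circuit y B : {set T} :=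
  odflt set0 [pick C | circuit C && (C \subset y |: B)].

Definition symdiff A B : {set T} := (A :\: B) :|: (B :\: A).

Lemma basis_indep B : basis B -> indep M B.
Proof. exact: maxsetp. Qed.

Lemma basis_max B e :
  basis B -> e \notin B -> ~~ indep M (e |: B).
Proof.
move=> /maxsetP[_ maxB] eNB; apply/negP => indeB.
by have := maxB _ indeB (subsetUr _ _) => eqB; rewrite -eqB setU11 in eNB.
Qed.

Lemma circuit_dep C : circuit C -> ~~ indep M C.
Proof. by move=> /minsetp/andP[]. Qed.

Lemma circuitD1 C e : circuit C -> e \in C -> indep M (C :\ e).
Proof.
move=> /minsetP[/andP[sCE _] minC] eC; apply/negPn/negP => depCe.
have /minC /(_ (subD1set _ _)) eqC : dependent (C :\ e).
  by rewrite /dependent depCe (subset_trans (subD1set _ _) sCE).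
by move: eC; rewrite -eqC !inE eqxx.
Qed.

Lemma fund_circuitP y B : basis B -> y \in ground M -> y \notin B ->
  circuit (fund_circuit y B) /\ fund_circuit y B \subset y |: B.
Proof.
move=> basB yE yNB; rewrite /fund_circuit; case: pickP => [C /andP[]//|noC].
have depyB : dependent (y |: B).
  rewrite /dependent basis_max // andbT subUset sub1set yE.
  exact: indep_ground (basis_indep basB).
have [C circC sC] := minset_exists depyB.
by have := noC C; rewrite /circuit circC sC.
Qed.

Lemma circuit_uniq y B C1 C2 : basis B -> y \notin B ->
  circuit C1 -> C1 \subset y |: B ->
  circuit C2 -> C2 \subset y |: B -> C1 = C2.
Proof.
move=> basB yNB circ1 sC1 circ2 sC2; apply/eqP/negPn/negP => neqC.
have /subsetPn[e eC1 eNC2] : ~~ (C1 \subset C2).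
  apply: contra neqC => s12; apply/eqP; have /minsetP[_ min2] := circ2.
  exact: min2 (minsetp circ1) s12.
pose P J := indep M J && (J \subset y |: B).
have PCe : P (C1 :\ e).
  by rewrite /P circuitD1 //= (subset_trans (subD1set _ _) sC1).
have [J /maxsetP[/andP[indJ sJ] maxJ] sCJ] := maxset_exists PCe.
have cardJ : #|B| <= #|J|.
  rewrite leqNgt; apply/negP => ltJB.
  have [f] := indep_aug indJ (basis_indep basB) ltJB.
  rewrite inE => /andP[fNJ fB] indfJ.
  have /maxJ /(_ (subsetUr _ _)) eqJ : P (f |: J).
    by rewrite /P indfJ subUset sJ sub1set inE fB orbT.
  by rewrite -eqJ setU11 in fNJ.
have eNJ : e \notin J.
  apply/negP => eJ; have := circuit_dep circ1; rewrite (indepS _ indJ) //.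
  by rewrite -(setD1K eC1) subUset sub1set eJ.
have eyB : e \in y |: B by apply: subsetP eC1.
have sJe : J \subset (y |: B) :\ e by rewrite subsetD1 sJ.
have eqJ : J = (y |: B) :\ e.
  apply/eqP; rewrite eqEcard sJe /=; apply: leq_trans cardJ.
  by have := cardsD1 e (y |: B); rewrite eyB cardsU1 yNB /= !add1n => -[->].
have := circuit_dep circ2; rewrite (indepS _ indJ) //.
by rewrite eqJ subsetD1 sC2.
Qed.

Lemma fund_circuit_uniq y B C : basis B -> y \in ground M -> y \notin B ->
  circuit C -> C \subset y |: B -> fund_circuit y B = C.
Proof.
move=> basB yE yNB circC sC; have [circ s] := fund_circuitP basB yE yNB.
exact: circuit_uniq basB yNB circ s circC sC.
Qed.

End Matroid.

(* Main.v *)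
Require Import Defs.
From mathcomp Require Import all_boot.
Set Implicit Arguments.
Unset Strict Implicit.
Unset Printing Implicit Defensive.

(* Write C1 = C(x, B), C2 = C(y, B) and D = C(y, B - b + x). Since a fundamental
   circuit is the only circuit in its set B + y, circuit elimination identifies
   each of the three in terms of the other two: eliminating b from C1 and C2
   gives D, eliminating y from D and C2 gives C1, and eliminating x from C1
   and D gives C2. So each of the three is contained in the union of the other
   two, which is what the two inclusions say. *)

Lemma exists_circuit (T : finType) (M : matroid T) (A : {set T}) :
  A \subset ground M -> ~~ indep M A -> exists2 C, circuit M C & C \subset A.
Proof.
move=> sAE depA; have depMA : dependent M A by rewrite /dependent sAE.
by have [C circC sCA] := minset_exists depMA; exists C.
Qed.

Lemma circuit_ground (T : finType) (M : matroid T) (C : {set T}) :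
  circuit M C -> C \subset ground M.
Proof. by move=> /minsetp/andP[]. Qed.

Lemma circuit_subset_eq (T : finType) (M : matroid T) (C1 C2 : {set T}) :
  circuit M C1 -> circuit M C2 -> C1 \subset C2 -> C1 = C2.
Proof. by move=> /minsetp dep1 /minsetP[_ min2] /(min2 _ dep1). Qed.

(** Suppose [U :\ e] is independent. For [f] in [C1] but not in [C2], extend [C1 :\ f] to a maximal
    independent subset [J] of [U]. As [J] contains neither circuit, it misses [f] and some [g] in
    [C2], so it is smaller than [U :\ e], and augmentation contradicts its maximality. *)
Lemma circuit_elim (T : finType) (M : matroid T) (C1 C2 : {set T}) (e : T) :
  circuit M C1 -> circuit M C2 -> C1 != C2 ->
  exists2 C, circuit M C & C \subset (C1 :|: C2) :\ e.
Proof.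
move=> circ1 circ2 neqC; set U := C1 :|: C2.
have sUE : U \subset ground M by rewrite subUset !circuit_ground.
apply: exists_circuit; first exact: subset_trans (subD1set _ _) sUE.
apply/negP => indUe.
have /subsetPn[f fC1 fNC2] : ~~ (C1 \subset C2).
  by apply: contra neqC => s12; apply/eqP/(circuit_subset_eq circ1 circ2).
pose P J := indep M J && (J \subset U).
have PCf : P (C1 :\ f).
  by rewrite /P circuitD1 //= (subset_trans (subD1set _ _)) ?subsetUl.
have [J /maxsetP[/andP[indJ sJU] maxJ] sCJ] := maxset_exists PCf.
have fNJ : f \notin J.
  apply/negP => fJ; have := circuit_dep circ1; rewrite (indepS _ indJ) //.
  by rewrite -(setD1K fC1) subUset sub1set fJ.
have /subsetPn[g gC2 gNJ] : ~~ (C2 \subset J).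
  by apply: contra (circuit_dep circ2) => /indepS; apply.
have neqgf : g != f by apply: contraNneq fNC2 => <-.
have ltJU : #|J| < #|U :\ e|.
  have fU : f \in U by rewrite inE fC1.
  have gUf : g \in U :\ f by rewrite !inE neqgf gC2 orbT.
  have /subset_leq_card leJ : J \subset U :\ f :\ g.
    by rewrite !subsetD1 sJU fNJ.
  have eqU : #|U| = #|U :\ f :\ g|.+2.
    by rewrite (cardsD1 f) fU (cardsD1 g (U :\ f)) gUf.
  (* Whether or not [e] lies in [U], removing it lowers the cardinality by at most one, while [J]
     misses two elements of [U]. *)
  apply: leq_ltn_trans leJ _; rewrite -ltnS -eqU (cardsD1 e).
  by case: (e \in U); rewrite ?ltnS.
have [h] := indep_aug indJ indUe ltJU; rewrite !inE => /and3P[hNJ _ hU] indhJ.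
have /maxJ /(_ (subsetUr _ _)) eqJ : P (h |: J).
  by rewrite /P indhJ subUset sJU sub1set inE hU.
by rewrite -eqJ setU11 in hNJ.
Qed.

(** An independent proper superset of [I] would be larger than [B], and augmentation would then
    enlarge the basis [B]. *)
Lemma basis_card (T : finType) (M : matroid T) (B I : {set T}) :
  basis M B -> indep M I -> #|B| <= #|I| -> basis M I.
Proof.
move=> basB indI leBI; apply/maxsetP; split=> // J indJ sIJ.
apply/eqP; rewrite eq_sym eqEcard sIJ /=; apply: leq_trans leBI.
rewrite leqNgt; apply/negP => ltBJ.
have [e] := indep_aug (basis_indep basB) indJ ltBJ.
by rewrite inE => /andP[eNB _]; apply/negP/basis_max.
Qed.

Lemma fund_circuit_mem (T : finType) (M : matroid T) (B : {set T}) (y : T) :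
  basis M B -> y \in ground M -> y \notin B -> y \in fund_circuit M y B.
Proof.
move=> basB yE yNB; have [circ sC] := fund_circuitP basB yE yNB.
apply: contraNT (circuit_dep circ) => yNC; apply: indepS (basis_indep basB).
by move: (subsetD1 (fund_circuit M y B) (y |: B) y); rewrite setU1K // sC yNC.
Qed.

(** A circuit inside B - b + x also lies in B + x, so by uniqueness it is C(x, B); but that circuit
    contains [b]. Hence B - b + x is independent, and it has as many elements as [B]. *)
Lemma basis_exchange (T : finType) (M : matroid T) (B : {set T}) (x b : T) :
  basis M B -> x \in ground M -> x \notin B -> b \in B ->
  b \in fund_circuit M x B -> basis M (x |: (B :\ b)).
Proof.
move=> basB xE xNB bB bC.
have sxB : x |: (B :\ b) \subset x |: B by rewrite setUS ?subD1set.
apply: (basis_card basB); last first.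
  by rewrite cardsU1 !inE (negPf xNB) andbF (cardsD1 b B) bB.
apply/negPn/negP => depI.
have sIE : x |: (B :\ b) \subset ground M.
  apply: subset_trans sxB _.
  by rewrite subUset sub1set xE (indep_ground (basis_indep basB)).
have [C circC sC] := exists_circuit sIE depI.
have eqC := fund_circuit_uniq basB xE xNB circC (subset_trans sC sxB).
have := subsetP sC b; rewrite -eqC bC !inE eqxx orbF => /(_ isT)/eqP eqbx.
by rewrite -eqbx bB in xNB.
Qed.

(** Elimination only yields some circuit; once it is confined to B + y, uniqueness identifies it as
    C(y, B). *)
Lemma fund_circuit_elim (T : finType) (M : matroid T) (B C1 C2 : {set T})
    (y e : T) :
  basis M B -> y \in ground M -> y \notin B ->
  circuit M C1 -> circuit M C2 -> C1 != C2 ->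
  (C1 :|: C2) :\ e \subset y |: B ->
  fund_circuit M y B \subset (C1 :|: C2) :\ e.
Proof.
move=> basB yE yNB circ1 circ2 neqC sCB.
have [C circC sC] := circuit_elim e circ1 circ2 neqC.
by rewrite (fund_circuit_uniq basB yE yNB circC (subset_trans sC sCB)).
Qed.

Theorem proposition2p2 (T : finType) (M : matroid T) (B : {set T}) (x y b : T)
  (hB : basis M B)
  (hxE : x \in ground M) (hxB : x \notin B)
  (hyE : y \in ground M) (hyB : y \notin B)
  (hxy : x != y)
  (hb : b \in fund_circuit M x B :&: fund_circuit M y B) :
  let Bbx := x |: (B :\ b) in
  [/\ basis M Bbx,
      symdiff (fund_circuit M x B) (fund_circuit M y B)
        \subset fund_circuit M y Bbx
    & fund_circuit M y Bbx
        \subset fund_circuit M x B :|: fund_circuit M y B].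
Proof.
move=> Bbx; set C1 := fund_circuit M x B in hb *.
set C2 := fund_circuit M y B in hb *; set D := fund_circuit M y Bbx.
have /setIP[bC1 bC2] := hb.
have [circ1 s1] : circuit M C1 /\ C1 \subset x |: B by exact: fund_circuitP.
have [circ2 s2] : circuit M C2 /\ C2 \subset y |: B by exact: fund_circuitP.
have xC1 : x \in C1 by exact: fund_circuit_mem.
have yNC1 : y \notin C1.
  by apply: contra hyB => /(subsetP s1); rewrite !inE eq_sym (negPf hxy).
have xNC2 : x \notin C2.
  by apply: contra hxB => /(subsetP s2); rewrite !inE (negPf hxy).
have neqbx : b != x by apply: contraNneq xNC2 => <-.
have neqby : b != y by apply: contraNneq yNC1 => <-.
have bB : b \in B by have := subsetP s1 b bC1; rewrite !inE (negPf neqbx).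
have basBbx : basis M Bbx by exact: basis_exchange.
have yNBbx : y \notin Bbx by rewrite !inE eq_sym (negPf hxy) (negPf hyB) andbF.
have [circD sD] : circuit M D /\ D \subset y |: Bbx by exact: fund_circuitP.
have bND : b \notin D.
  apply/negP => /(subsetP sD).
  by rewrite !inE eqxx (negPf neqbx) (negPf neqby).
have sub1 z : z \in C1 -> (z == x) || (z \in B).
  by move=> /(subsetP s1); rewrite !inE.
have sub2 z : z \in C2 -> (z == y) || (z \in B).
  by move=> /(subsetP s2); rewrite !inE.
have subD z : z \in D -> [|| z == y, z == x | z \in B].
  move=> /(subsetP sD); rewrite !inE.
  by case/or3P=> [->|->|/andP[_ ->]]; rewrite ?orbT.
(* [C1] and [C2] differ because only [C1] contains [x]; without [b], their union lies in B - b + x +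
   y. *)
have D12 : D \subset (C1 :|: C2) :\ b.
  apply: fund_circuit_elim => //; first by apply: contraNneq xNC2 => <-.
  apply/subsetP => z; rewrite !inE => /andP[-> /orP[/sub1|/sub2]];
    by case/orP=> ->; rewrite ?orbT.
(* Here the two circuits differ at [b], which [D] avoids; the fundamental circuit is again taken
   with respect to [B]. *)
have C1D2 : C1 \subset (D :|: C2) :\ y.
  apply: fund_circuit_elim => //; first by apply: contraNneq bND => ->.
  apply/subsetP => z; rewrite !inE => /andP[/negPf zNy /orP[/subD|/sub2]];
    by rewrite zNy //= => ->; rewrite orbT.
have C2D1 : C2 \subset (D :|: C1) :\ x.
  apply: fund_circuit_elim => //; first by apply: contraNneq bND => ->.
  apply/subsetP => z; rewrite !inE => /andP[/negPf zNx /orP[/subD|/sub1]];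
    by rewrite zNx //= => ->; rewrite orbT.
split=> //; last exact: subset_trans D12 (subD1set _ _).
(* An element of [C1] outside [C2] must come from [D] by [C1D2]; [C2D1] settles the other half in
   the same way. *)
apply/subsetP => z; rewrite !inE => /orP[/andP[/negPf zN /(subsetP C1D2)]|].
  by rewrite !inE zN orbF => /andP[].
by move=> /andP[/negPf zN /(subsetP C2D1)]; rewrite !inE zN orbF => /andP[].
Qed.
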